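(* Let $m\ge 3$ and $n\ge 2$ be integers and let $\mathscr{A}=(a_{i_1\cdots i_m})\in\mathbb{T}_{m,n}$. Let $\mathscr{A}_{1\cdots 1}:=(a_{i_1\cdots i_m})$ with $i_1,\ldots,i_m\in[n]\setminus\{1\}$ and $\mathscr{A}_{2\cdots 2}:=(a_{i_1\cdots i_m})$ with $i_1,\ldots,i_m\in[n]\setminus\{2\}$ (both regarded as $m$-order $(n-1)$-dimensional tensors). Suppose that $a_{1i_2\cdots i_m}=a_{2i_2\cdots i_m}$ for all $i_2,\ldots,i_m\in[n]$, and that both $\mathscr{A}_{1\cdots 1}$ and $\mathscr{A}_{2\cdots 2}$ are $Q$-tensors. Then $\mathscr{A}$ is a $Q$-tensor.
   Context: $[n]=\{1,\ldots,n\}$. $\mathbb{T}_{m,n}$ is the set of real $m$-order $n$-dimensional tensors $\mathscr{A}=(a_{i_1\cdots i_m})$, $a_{i_1\cdots i_m}\in\mathbb{R}$ for $i_1,\ldots,i_m\in[n]$ (no symmetry assumed). For $x\in\mathbb{R}^n$, $\mathscr{A}x^{m-1}\in\mathbb{R}^n$ is defined by $(\mathscr{A}x^{m-1})_i=\sum_{i_2,\ldots,i_m=1}^n a_{ii_2\cdots i_m}x_{i_2}\cdots x_{i_m}$. An $m$-order $n$-dimensional tensor $\mathscr{A}$ (any dimension $n\ge 1$) is a $Q$-tensor if for every $q\in\mathbb{R}^n$ there is $x\in\mathbb{R}^n$ with $x\ge 0$, $\mathscr{A}x^{m-1}+q\ge 0$ and $x^T(\mathscr{A}x^{m-1}+q)=0$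 (inequalities componentwise). *)

(* Defs.v *)
From HB Require Import structures.
From mathcomp Require Import all_boot all_order all_algebra.
From mathcomp Require Import reals.

Set Implicit Arguments.
Unset Strict Implicit.
Unset Printing Implicit Defensive.

Import Order.TTheory GRing.Theory Num.Theory.
Local Open Scope ring_scope.

Definition tensor (R : realType) (m n : nat) : Type :=
  {ffun m.-tuple 'I_n -> R}.

(* For a tensor of order m.+1 this is A x^m, i.e. "A x^(order - 1)". *)
Definition tensor_app (R : realType) (m n : nat)
    (A : tensor R m.+1 n) (x : 'cV[R]_n) : 'cV[R]_n :=
  \col_(i < n) \sum_(t : m.-tuple 'I_n)
    A [tuple of i :: t] * \prod_(k < m) x (tnth t k) 0.

Definition nonneg_cV (R : realType) (n : nat) (x : 'cV[R]_n) : Prop :=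
  forall i : 'I_n, 0 <= x i 0.

Definition Q_tensor (R : realType) (m n : nat) (A : tensor R m.+1 n) : Prop :=
  forall q : 'cV[R]_n, exists x : 'cV[R]_n,
    [/\ nonneg_cV x,
        nonneg_cV (tensor_app A x + q)
      & x^T *m (tensor_app A x + q) = 0].

(* The subtensor of A with all indices in [n] \ {k}; [lift k] is the increasing
   bijection from 'I_n.-1 onto 'I_n \ {k}. *)
Definition subtensor (R : realType) (m n : nat) (k : 'I_n)
    (A : tensor R m n) : tensor R m n.-1 :=
  [ffun t : m.-tuple 'I_n.-1 => A [tuple of map (lift k) t]].

(* Main.v *)
Require Import Defs.
From HB Require Import structures.
From mathcomp Require Import all_boot all_order all_algebra.
From mathcomp Require Import reals.

Set Implicit Arguments.
Unset Strict Implicit.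
Unset Printing Implicit Defensive.

Import Order.TTheory GRing.Theory Num.Theory.
Local Open Scope ring_scope.

(** Say q_1 <= q_2. Solve the complementarity problem for A_{2...2} and the
    restriction of q, and extend the solution by 0 at index 2. The rows other
    than 2 are unaffected, and row 2 of A x^(m-1) + q dominates row 1 because
    the two slices of A agree. The case q_2 <= q_1 is symmetric. *)

Definition zero_extend (R : realType) (n : nat) (k : 'I_n) (y : 'cV[R]_n.-1) :
    'cV[R]_n :=
  \col_i oapp (fun j => y j 0) 0 (unlift k i).

Lemma zero_extend_lift (R : realType) (n : nat) (k : 'I_n) (y : 'cV[R]_n.-1)
    (i : 'I_n.-1) :
  zero_extend k y (lift k i) 0 = y i 0.
Proof. by rewrite mxE liftK. Qed.

Lemma zero_extend_id (R : realType) (n : nat) (k : 'I_n) (y : 'cV[R]_n.-1) :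
  zero_extend k y k 0 = 0.
Proof. by rewrite mxE unlift_none. Qed.

(** A monomial whose index tuple meets [k] has a zero factor; the tuples avoiding [k] are exactly
    the images under [lift k] of tuples over the smaller index set. *)
Lemma tensor_app_zero_extend (R : realType) (m n : nat) (k : 'I_n)
    (A : tensor R m.+1 n) (y : 'cV[R]_n.-1) (i : 'I_n.-1) :
  tensor_app A (zero_extend k y) (lift k i) 0
  = tensor_app (subtensor k A) y i 0.
Proof.
rewrite !mxE (bigID (fun t : m.-tuple 'I_n => k \notin t)) /=.
rewrite [X in _ + X]big1 ?addr0; last first.
  move=> t /negPn /tnthP [l kE].
  by rewrite (bigD1 l) //= -kE zero_extend_id mul0r mulr0.
(* The default [i] only makes the inverse map total: it is never reached on tuples avoiding [k]. *)
rewrite (reindex_onto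
  (fun s : m.-tuple 'I_n.-1 => [tuple of map (lift k) s])
  (fun t : m.-tuple 'I_n =>
     [tuple of map (fun j => odflt i (unlift k j)) t])) /=; last first.
  move=> t kNt; apply: val_inj; rewrite /= -map_comp map_id_in // => j jt /=.
  case: unliftP => [//|jk].
  by rewrite -jk jt in kNt.
apply: eq_big => [s|s _].
  apply/andP; split.
    by apply/negP => /mapP [j _ /eqP]; rewrite (negPf (neq_lift _ _)).
  by apply/eqP/val_inj; rewrite /= -map_comp map_id_in // => j _; rewrite /= liftK.
rewrite ffunE; congr (A _ * _); first exact: val_inj.
by apply: eq_bigr => l _; rewrite tnth_map zero_extend_lift.
Qed.

(** Index [k] is the one deleted. Keeping [j] and [k] arbitrary lets one argument serve both
    orderings of the two entries of [q]. *)
Lemma dominated_row_solution (R : realType) (m n : nat) (j k : 'I_n)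
    (A : tensor R m.+1 n) (q : 'cV[R]_n) :
  k != j ->
  (forall t : m.-tuple 'I_n, A [tuple of j :: t] = A [tuple of k :: t]) ->
  q j 0 <= q k 0 ->
  Q_tensor (subtensor k A) ->
  exists x : 'cV[R]_n,
    [/\ nonneg_cV x,
        nonneg_cV (tensor_app A x + q)
      & x^T *m (tensor_app A x + q) = 0].
Proof.
move=> kj Ajk qjk /(_ (\col_i q (lift k i) 0)) [y [y_ge0 r_ge0 yr0]].
pose x := zero_extend k y.
have resE i : (tensor_app A x + q) (lift k i) 0
    = (tensor_app (subtensor k A) y + \col_i q (lift k i) 0) i 0.
  by rewrite mxE tensor_app_zero_extend [RHS]mxE [X in _ = _ + X]mxE.
have res_ge0 i : 0 <= (tensor_app A x + q) (lift k i) 0 by rewrite resE.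
exists x; split.
- move=> i; case: (unliftP k i) => [i' ->|->].
    by rewrite zero_extend_lift.
  by rewrite zero_extend_id.
- move=> i; case: (unliftP k i) => [i' ->|->]; first exact: res_ge0.
  (* Row [j] survives the deletion, so its residual is already nonnegative; row [k] exceeds it by
     [q k 0 - q j 0]. *)
  have [j' jE _] := unlift_some kj.
  apply: le_trans (res_ge0 j') _; rewrite -jE mxE [leRHS]mxE lerD //.
  by rewrite !mxE; under eq_bigr do rewrite Ajk.
- apply/matrixP => a b; rewrite !ord1 mxE [RHS]mxE.
  move/matrixP/(_ 0 0): yr0; rewrite mxE [X in _ = X -> _]mxE; apply: etrans.
  (* The residual in row [k] may be positive, but its weight [x k 0] is zero; the other terms form
     the inner product of the smaller problem. *)
  rewrite (bigD1_ord k) //= [x^T 0 k]mxE zero_extend_id mul0r add0r.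
  apply: eq_bigr => i _.
  by rewrite resE [x^T 0 _]mxE [y^T 0 _]mxE zero_extend_lift.
Qed.

(* The order of the tensor is m.+1; the indices 1 and 2 of [n] are the
   elements 0 and 1 of 'I_n. *)
Theorem theorem2p1 (R : realType) (m n : nat)
    (hm : (3 <= m.+1)%N) (hn : (2 <= n)%N) (A : tensor R m.+1 n) :
  let i1 : 'I_n := Ordinal (ltnW hn) in
  let i2 : 'I_n := Ordinal hn in
  (forall t : m.-tuple 'I_n, A [tuple of i1 :: t] = A [tuple of i2 :: t]) ->
  Q_tensor (subtensor i1 A) ->
  Q_tensor (subtensor i2 A) ->
  Q_tensor A.
Proof.
move=> i1 i2 A12 Q1 Q2 q.
have [q12|/ltW q21] := leP (q i1 0) (q i2 0).
  exact: (@dominated_row_solution _ _ _ i1 i2).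
by apply: (@dominated_row_solution _ _ _ i2 i1).
Qed.
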